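(* Let $p$ be a prime and let $G$ be a finite $p$-group of nilpotency class $3$. If $G/Z(G)$ is $2$-generated and $Z(G)$ is not cyclic, then $\mathrm{Aut}(G)$ contains a noninner automorphism of order $p$ leaving $\Phi(G)$ elementwise fixed.
   Context: $Z(G)$ denotes the center, $\Phi(G)$ the Frattini subgroup and $\mathrm{Aut}(G)$ the automorphism group of $G$. An automorphism leaves a subgroup elementwise fixed if it fixes each of its elements. A group is $2$-generated if it can be generated by two elements. *)

(* Defs.v *)
From mathcomp Require Import all_boot all_fingroup all_solvable.

Set Implicit Arguments.
Unset Strict Implicit.
Unset Printing Implicit Defensive.

(* Main.v *)
Require Import Defs.
From mathcomp Require Import all_boot all_fingroup all_solvable.
Local Open Scope group_scope.

(** Write Z = Z(G) and W = Omega_1(Z), an elementary abelian group of order at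
    least p ^ 2 because Z is not cyclic.  A homomorphism f from G to W kills
    Phi(G), since its image is elementary abelian; if it also satisfies
    f o f = 1, then g |-> g * f g is an automorphism of order dividing p that
    fixes Phi(G) elementwise.  Such an automorphism is inner only if
    f g = [g, x] for some fixed x in G, so it suffices to find f which is not
    of that form ([central_noninner_automorphism]).  Homomorphisms to W are
    built by mapping G / M, of order p for M maximal, onto a subgroup of W
    ([morphism_killing_maximal]).

    If W is not contained in Phi(G), pick z in W outside Phi(G), a maximal
    subgroup M containing z, and f with kernel M and image <z>; then f o f = 1.
    The automorphism is not inner, as otherwise z would be a commutator and
    thus lie in Phi(G).

    If W is contained in Phi(G), then f o f = 1 is automatic and one can count.
    The group G is not cyclic, so it has two maximal subgroups M1 and M2, and
    for b in M2 \ M1 and c in M1 \ M2 the pair (f b, f c) can be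
    prescribed arbitrarily in W x W, taking for f the product of a homomorphism
    that kills M1 and one that kills M2: this leaves at least p ^ 4 possibilities.
    When f g = [g, x] for all g, the coset x Z belongs to Omega_1(Z(G / Z)) and
    determines f.  But G / Z has class 2 and two generators, so that this group
    has order at most p ^ 3 ([card_Ohm1_center_2gen]), and some pair in W x W
    is missed by the inner automorphisms ([noncommutator_pair]). *)

(** Here f (f g) = 1 does two jobs: it makes g |-> g * f g injective, and it
    makes the n-th power of this map equal to g |-> g * f g ^+ n, whence the
    order p.  Noninnerness is a condition on f alone because conjugation by x is
    g |-> g * [~ g, x]. *)
Lemma central_noninner_automorphism (p : nat) (gT : finGroupType)
    (G : {group gT}) (f : {morphism G >-> gT}) :
    prime p -> p.-group G -> f @* G \subset 'Ohm_1('Z(G)) ->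
    {in G, forall g, f (f g) = 1} ->
    (forall x, x \in G -> exists2 g, g \in G & f g != [~ g, x]) ->
  exists a : {perm gT},
    [/\ a \in Aut G, a \notin conj_aut G @* G, #[a] = p
      & {in 'Phi(G), forall x, a x = x}].
Proof.
move=> p_pr pG imf ff ninn.
have abW : p.-abelem 'Ohm_1('Z(G)).
  by rewrite Ohm1_abelem ?center_abelian // (pgroupS (center_sub G)).
have fW g : g \in G -> f g \in 'Ohm_1('Z(G)).
  by move=> Gg; rewrite (subsetP imf) // mem_morphim.
have fZ g : g \in G -> f g \in 'Z(G).
  by move=> Gg; rewrite (subsetP (Ohm_sub 1 _)) // fW.
have fG g : g \in G -> f g \in G.
  by move=> Gg; rewrite (subsetP (center_sub G)) // fZ.
have hM : {in G &, {morph (fun g => g * f g) : x y / x * y}}.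
  move=> x y Gx Gy /=; rewrite morphM // !mulgA; congr (_ * _).
  by rewrite -!mulgA; congr (_ * _); case/centerP: (fZ x Gx) => _ ->.
pose h := Morphism hM.
have injh : 'injm h.
  apply/subsetP=> g /morphpreP[Gg /set1P/= hg1].
  have fg1 : f g = 1.
    have /eqP def_fg: g^-1 == f g by rewrite eq_invg_mul hg1.
    by apply: invg_inj; rewrite invg1 -morphV // def_fg ff.
  by rewrite inE -hg1 fg1 mulg1.
have imh : h @* G = G.
  apply/eqP; rewrite eqEcard card_injm // leqnn andbT.
  by apply/subsetP=> _ /morphimP[g Gg _ ->] /=; rewrite groupM ?fG.
have hE : {in G, aut injh imh =1 h} := autE injh imh.
have aE g : g \in G -> aut injh imh g = g * f g by move=> Gg; rewrite hE.
have Aa := Aut_aut injh imh.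
have aInn : aut injh imh \notin conj_aut G @* G.
  apply/morphimP=> -[x Nx Gx def_a]; have [g Gg /eqP[]] := ninn x Gx.
  by apply: (mulgI g); rewrite -aE // def_a norm_conj_autE // conjg_mulR.
exists (aut injh imh); split=> //.
  apply: nt_prime_order => //; last first.
    by apply: contraNneq aInn => ->; rewrite group1.
  have aX n g : g \in G -> (aut injh imh ^+ n) g = g * f g ^+ n.
    move=> Gg; elim: n => [|n IHn]; first by rewrite perm1 mulg1.
    rewrite expgSr permM IHn aE ?groupM ?groupX ?fG //.
    by rewrite morphM ?morphX ?groupX ?fG // ff // expg1n mulg1 expgSr mulgA.
  apply/permP=> g; rewrite perm1; have [Gg | notGg] := boolP (g \in G).
    by rewrite aX //; case/(abelemP p_pr): abW => _ ->; rewrite ?mulg1 ?fW.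
  by apply: (out_Aut _ notGg); rewrite groupX.
(* The image of f is elementary abelian, so its Frattini subgroup is trivial. *)
have fPhi : f @* 'Phi(G) = 1.
  rewrite (morphim_Phi f pG) //; apply/eqP.
  by rewrite (trivg_Phi (morphim_pgroup f pG)) (abelemS imf).
move=> x Px; have Gx := subsetP (Phi_sub G) x Px.
rewrite aE //; suff /set1P->: f x \in [1 gT] by rewrite mulg1.
by rewrite -fPhi mem_morphim.
Qed.

(** The quotient of G by M is cyclic of order p, generated by the coset of a,
    so that coset can be sent to any element whose p-th power is trivial. *)
Lemma morphism_killing_maximal (p : nat) (gT : finGroupType)
    (G M : {group gT}) (a u : gT) :
    prime p -> p.-group G -> maximal M G -> a \in G :\: M -> u ^+ p = 1 ->
  exists f : {morphism G >-> gT},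
    [/\ f a = u, {in M, forall x, f x = 1} & f @* G \subset <[u]>].
Proof.
move=> p_pr pG maxM /setDP[Ga notMa] up1.
have nsMG := p_maximal_normal pG maxM; have nMG := normal_norm nsMG.
have Na := subsetP nMG a Ga.
have oGM : #|G / M| = p by rewrite card_quotient // (p_maximal_index pG maxM).
have oa : #[coset M a] = p.
  apply: nt_prime_order => //; last first.
    by apply: contraNneq notMa; apply: coset_idr.
  apply/eqP; rewrite -order_dvdn -[in X in _ %| X]oGM order_dvdG //.
  exact: mem_quotient.
have defGM : G / M = <[coset M a]>.
  apply/esym/eqP; rewrite eqEcard cycle_subG mem_quotient //=.
  by rewrite -orderE oa oGM.
have dvd_u : #[u] %| #[coset M a] by rewrite oa order_dvdn up1.
have GMc g : g \in G -> coset M g \in <[coset M a]>.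
  by move=> Gg; rewrite -defGM mem_quotient.
have fM : {in G &, {morph (fun g => eltm dvd_u (coset M g)) : x y / x * y}}.
  move=> x y Gx Gy /=.
  by rewrite morphM ?(subsetP nMG) // (morphM (eltm_morphism dvd_u)) ?GMc.
exists (Morphism fM); split=> /= [|x Mx|]; first exact: eltm_id.
  by rewrite (coset_id Mx) (morph1 (eltm_morphism dvd_u)).
apply/subsetP=> _ /morphimP[g _ Gg ->] /=.
by have /cycleP[i ->] := GMc g Gg; rewrite eltmE mem_cycle.
Qed.

(** The derived subgroup of H is cyclic, generated by the commutator of the two
    generators, because commutators are central; hence it meets the
    elementary abelian group 'Ohm_1('Z(H)) in a group of order at most p.  The
    image of 'Ohm_1('Z(H)) in the abelian 2-generated group H / H^`(1) has
    order at most p ^ 2. *)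
Lemma card_Ohm1_center_2gen (p : nat) (hT : finGroupType) (H : {group hT})
    (u v : hT) :
    prime p -> p.-group H -> H^`(1) \subset 'Z(H) -> H :=: <<[set u; v]>> ->
  #|'Ohm_1('Z(H))| <= p ^ 3.
Proof.
move=> p_pr pH sH'Z defH.
have defH2 : H :=: <[u]> <*> <[v]> by rewrite joing_idl joing_idr.
have cycH' : cyclic H^`(1).
  rewrite defH2 der1_joing_cycles ?cycle_cyclic //.
  rewrite -defH2; apply: (subsetP (subset_trans sH'Z (subsetIr _ _))).
  by rewrite mem_commg // defH mem_gen // !inE eqxx ?orbT.
set W := 'Ohm_1('Z(H)).
have sWH : W \subset H := subset_trans (Ohm_sub 1 _) (center_sub H).
have pW : p.-group W := pgroupS sWH pH.
have abW : p.-abelem W.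
  by rewrite Ohm1_abelem ?center_abelian // (pgroupS (center_sub H)).
have nH'W : W \subset 'N(H^`(1)) := subset_trans sWH (der_norm 1 H).
have abWq : p.-abelem (W / H^`(1)) := morphim_abelem _ abW.
have abWi : p.-abelem (W :&: H^`(1)) := abelemS (subsetIl _ _) abW.
have le1 : logn p #|W :&: H^`(1)| <= 1.
  rewrite -(p_rank_abelem abWi) -(rank_pgroup (abelem_pgroup abWi)).
  rewrite -abelian_rank1_cyclic ?(abelem_abelian abWi) //.
  exact: cyclicS (subsetIr _ _) cycH'.
have le2 : logn p #|W / H^`(1)| <= 2.
  rewrite -(p_rank_abelem abWq).
  apply: leq_trans (p_rankS p (quotientS _ sWH)) _.
  rewrite -(rank_pgroup (quotient_pgroup _ pH)) -grank_abelian ?der_abelian //.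
  have nH'X : [set u; v] \subset 'N(H^`(1)).
    by rewrite -gen_subG -defH der_norm.
  have /= -> : H / H^`(1) = <<[set u; v] / H^`(1)>>.
    by rewrite -quotient_gen // -defH.
  apply: leq_trans (grank_min _) _.
  by apply: leq_trans (leq_morphim _ _) _; rewrite cards2; case: (_ != _).
have oW : #|W| = (#|W :&: H^`(1)| * #|W / H^`(1)|)%N.
  by rewrite card_quotient // -(Lagrange (subsetIl W H^`(1))) indexgI.
rewrite (card_pgroup pW) leq_exp2l ?prime_gt1 // oW.
by rewrite lognM ?cardG_gt0 // (leq_add le1 le2).
Qed.

(** Counting: modulo 'Z(G), the elements x with all [~ g, x] in 'Ohm_1('Z(G))
    form a subset of 'Ohm_1('Z(G / 'Z(G))), of order at most p ^ 3, while there
    are at least p ^ 4 pairs (u, v). *)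
Lemma noncommutator_pair (p : nat) (gT : finGroupType) (G : {group gT})
    (a b : gT) :
    prime p -> p.-group G -> ~~ cyclic 'Z(G) ->
    #|'Ohm_1('Z(G / 'Z(G)))| <= p ^ 3 -> a \in G -> b \in G ->
  exists u v : gT,
    [/\ u \in 'Ohm_1('Z(G)), v \in 'Ohm_1('Z(G))
      & forall x, x \in G ->
          (forall g, g \in G -> [~ g, x] \in 'Ohm_1('Z(G))) ->
        [~ a, x] = u -> [~ b, x] <> v].
Proof.
move=> p_pr pG ncycZ leW Ga Gb; set Z := 'Z(G); set W := 'Ohm_1(Z).
have pZ : p.-group Z := pgroupS (center_sub G) pG.
have abW : p.-abelem W by rewrite Ohm1_abelem ?center_abelian.
pose T := 'Ohm_1('Z(G / Z)).
(* Commutators with x depend only on the coset of x modulo the center, so c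
   sends that coset to ([~ a, x], [~ b, x]); see cE below. *)
pose c (X : coset_of Z) := ([~ a, repr X], [~ b, repr X]).
have geW : p ^ 2 <= #|W|.
  rewrite (card_pgroup (abelem_pgroup abW)) (leq_exp2l _ _ (prime_gt1 p_pr)).
  rewrite -(p_rank_abelem abW) p_rank_Ohm1 -(rank_pgroup pZ) ltnNge.
  by rewrite -abelian_rank1_cyclic ?center_abelian.
have /subsetPn[[u v] /setXP[/= Wu Wv] notTuv] :
  ~~ (setX W W \subset [set c X | X in T]).
  apply/negP=> /subset_leq_card; rewrite cardsX => leWc.
  have := leq_trans leWc (leq_trans (leq_imset_card _ _) leW).
  rewrite leqNgt => /negP[]; apply: leq_trans (leq_mul geW geW).
  by rewrite -expnD ltn_exp2l ?prime_gt1.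
exists u, v; split=> // x Gx Wx def_u def_v; case/negP: notTuv.
have Nx := subsetP (normal_norm (center_normal G)) x Gx.
have Zx g : g \in G -> [~ g, x] \in Z.
  by move=> Gg; rewrite (subsetP (Ohm_sub 1 _)) ?Wx.
have cE g : g \in G -> [~ g, repr (coset Z x)] = [~ g, x].
  move=> Gg; have := mem_repr_coset (coset Z x).
  rewrite val_coset // => /rcosetP[z /centerP[_ cz] ->].
  suff /commgP/eqP gz1 : commute g z by rewrite commgMJ gz1 conj1g mulg1.
  exact/esym/cz.
(* As [~ g, x] is central of exponent p for all g, the coset of x is central in
   G / Z and [~ g, x ^+ p] = [~ g, x] ^+ p = 1, so that x ^+ p lies in Z. *)
apply/imsetP; exists (coset Z x); last by rewrite /c !cE // def_u def_v.
rewrite /T (OhmE 1 (pgroupS (center_sub _) (quotient_pgroup _ pG))) expn1.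
apply: mem_gen; rewrite !inE mem_quotient //=; apply/andP; split.
  apply/centP=> _ /morphimP[g Ng Gg ->].
  apply/esym/commgP; rewrite -morphR //=; apply/eqP.
  by rewrite coset_id // Zx.
rewrite -morphX //; apply/eqP; apply: coset_id.
apply/centerP; split=> [|g Gg]; first exact: groupX.
apply/esym/commgP; rewrite commgX.
  by case/(abelemP p_pr): abW => _ ->; rewrite ?Wx.
by case/centerP: (Zx g Gg) => _ /(_ x Gx)/esym.
Qed.

Arguments morphism_killing_maximal {p gT G M a u}.
Arguments noncommutator_pair {p gT G a b}.

Theorem theorem2p9 (p : nat) (gT : finGroupType) (G : {group gT})
    (p_pr : prime p) (pG : p.-group G) (class3 : nil_class G = 3)
    (gen2 : exists u v : coset_of 'Z(G), G / 'Z(G) = <<[set u; v]>>)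
    (ncycZ : ~~ cyclic 'Z(G)) :
  exists f : {perm gT},
    [/\ f \in Aut G, f \notin conj_aut G @* G, #[f] = p
      & {in 'Phi(G), forall x, f x = x}].
Proof.
have [u0 [v0 defGZ]] := gen2; set Z := 'Z(G); set W := 'Ohm_1(Z).
have pZ : p.-group Z := pgroupS (center_sub G) pG.
have abW : p.-abelem W by rewrite Ohm1_abelem ?center_abelian.
have Wp w : w \in W -> w ^+ p = 1 by case/(abelemP p_pr): abW => _; apply.
have sWG : W \subset G := subset_trans (Ohm_sub 1 _) (center_sub G).
have maxOver x : x \in G -> exists2 M : {group gT}, maximal M G & x \in M.
  rewrite -cycle_subG => sxG.
  have [defG | [M maxM]] := maximal_exists sxG; last first.
    by rewrite cycle_subG; exists M.
  by case/negP: ncycZ; rewrite (cyclicS (center_sub G)) // -defG cycle_cyclic.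
have [sWPhi | /subsetPn[z Wz notPhiz]] := boolP (W \subset 'Phi(G)).
  have [M1 maxM1 _] := maxOver 1 (group1 G).
  have [sM1G [b Gb notM1b]] := properP (maxgroupp maxM1).
  have [M2 maxM2 M2b] := maxOver b Gb.
  have prM2 := maxgroupp maxM2.
  have /subsetPn[c M1c notM2c] : ~~ (M1 \subset M2).
    apply: contra notM1b => sM12.
    by have [_ /(_ M2 prM2 sM12) <-] := maxgroupP maxM1.
  have Gc := subsetP sM1G c M1c.
  have leT : #|'Ohm_1('Z(G / Z))| <= p ^ 3.
    apply: card_Ohm1_center_2gen defGZ => //; first exact: quotient_pgroup.
    by rewrite -nil_class2 nil_class_quotient_center ?(pgroup_nil pG) ?class3.
  have [u [v [Wu Wv notuv]]] :=
    noncommutator_pair p_pr pG ncycZ leT Gb Gc.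
  have Db : b \in G :\: M1 by apply/setDP.
  have Dc : c \in G :\: M2 by apply/setDP.
  have [f1 [f1b f1M im1]] :=
    morphism_killing_maximal p_pr pG maxM1 Db (Wp u Wu).
  have [f2 [f2c f2M im2]] :=
    morphism_killing_maximal p_pr pG maxM2 Dc (Wp v Wv).
  have f1W g : g \in G -> f1 g \in W.
    move=> Gg; apply: (subsetP (subset_trans im1 _)); last exact: mem_morphim.
    by rewrite cycle_subG.
  have f2W g : g \in G -> f2 g \in W.
    move=> Gg; apply: (subsetP (subset_trans im2 _)); last exact: mem_morphim.
    by rewrite cycle_subG.
  have fM : {in G &, {morph (fun g => f1 g * f2 g) : x y / x * y}}.
    move=> x y Gx Gy /=; rewrite !morphM // !mulgA; congr (_ * _).
    rewrite -!mulgA; congr (_ * _); apply: (centsP (abelem_abelian abW)).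
      exact: f1W.
    exact: f2W.
  apply: (@central_noninner_automorphism p gT G (Morphism fM)) => //=.
  - by apply/subsetP=> _ /morphimP[g _ Gg ->] /=; rewrite groupM ?f1W ?f2W.
  - move=> g Gg; have Phifg: f1 g * f2 g \in 'Phi(G).
      by rewrite (subsetP sWPhi) // groupM ?f1W ?f2W.
    have M1fg := subsetP (Phi_sub_max maxM1) _ Phifg.
    have M2fg := subsetP (Phi_sub_max maxM2) _ Phifg.
    by rewrite f1M // f2M // mulg1.
  move=> x Gx; apply/exists_inP; apply: contraT => /exists_inPn innx.
  have fE g : g \in G -> [~ g, x] = f1 g * f2 g.
    by move=> Gg; apply/esym/eqP; rewrite -[_ == _]negbK innx.
  case: (notuv x Gx) => [g Gg||]; first by rewrite fE // groupM ?f1W ?f2W.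
    by rewrite fE // f1b f2M ?mulg1.
  by rewrite fE // f2c f1M ?mul1g.
have [M maxM Mz] := maxOver z (subsetP sWG z Wz).
have [_ [a Ga notMa]] := properP (maxgroupp maxM).
have Da : a \in G :\: M by apply/setDP.
have [f [fa fM imf]] := morphism_killing_maximal p_pr pG maxM Da (Wp z Wz).
apply: (@central_noninner_automorphism p gT G f) => //.
- by rewrite (subset_trans imf) // cycle_subG.
- move=> g Gg; apply: fM; apply: (subsetP (subset_trans imf _)).
    by rewrite cycle_subG.
  exact: mem_morphim.
move=> x Gx; exists a => //; rewrite fa; apply: contraNneq notPhiz => ->.
by rewrite (Phi_joing pG) (subsetP (joing_subl _ _)) ?mem_commg.
Qed.
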